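(* Let $G$ be a finite simple graph without isolated vertices, with vertex set $V(G)=\{t_1,\ldots,t_s\}$, $s\geq 1$, let $S=K[t_1,\ldots,t_s]$ be a polynomial ring over a field $K$, and let $I=I(G)\subset S$ be the edge ideal of $G$. Then $G$ is in $W_2$ if and only if $\mathrm{v}(I)=\dim(S/I)$.
   Context: The edge ideal $I(G)$ is the ideal of $S$ generated by all $t_it_j$ with $\{t_i,t_j\}\in E(G)$. $\dim$ denotes Krull dimension. A set of vertices is stable if it contains no edge; a maximum stable set is a stable set of largest cardinality. $G$ belongs to the class $W_2$ if $|V(G)|\geq 2$ and any $2$ disjoint stable sets are contained in $2$ disjoint maximum stable sets (each of the two stable sets being contained in one of the two disjoint maximum stable sets). With the standard grading $S=\bigoplus_{d\ge0}S_d$, and for $I\subsetneq\mathfrak{m}=(t_1,\ldots,t_s)$, the v-number is $\mathrm{v}(I)=\min\{d\geq 1 \mid \exists f\in S_d \text{ and }\mathfrak{p}\in\mathrm{Ass}(I)\text{ with }(I\colon f)=\mathfrak{p}\}$, where $\mathrm{Ass}(I)$ is the set of associated primes of $S/I$ and $(I\colon f)=\{g\in S\mid gf\in I\}$. *)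

(* Defs.v *)
From HB Require Import structures.
From mathcomp Require Import all_boot all_order all_algebra.
From mathcomp Require Import boolp.
From mathcomp Require Import mpoly.

Set Implicit Arguments.
Unset Strict Implicit.
Unset Printing Implicit Defensive.

Import GRing.Theory.
Local Open Scope ring_scope.
Local Open Scope quotient_scope.

(* A finite simple graph is a symmetric irreflexive relation on a finType; the
   symmetry and irreflexivity are hypotheses of the theorem. *)
Section W2.
Variables (V : finType) (e : rel V).

Definition stable (A : {set V}) : Prop :=
  forall i j, i \in A -> j \in A -> ~~ e i j.

(* Maximum means of largest cardinality, not maximal for inclusion
   (compare [maxset]). *)
Definition max_stable (A : {set V}) : Prop :=
  stable A /\ forall B : {set V}, stable B -> (#|B| <= #|A|)%N.

Definition W2 : Prop :=
  (2 <= #|V|)%N /\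
  forall A B : {set V}, stable A -> stable B -> [disjoint A & B] ->
    exists A' B' : {set V},
      [/\ max_stable A', max_stable B', [disjoint A' & B'],
          A \subset A' & B \subset B'].
End W2.

(* The library's ideals are boolean predicates and are proper by definition.
   With the axioms of [boolp] every subset is given by a boolean predicate, so
   [prime_idealr R] ranges over all prime ideals of R. *)
Section KrullDimension.
Variable R : comNzRingType.

Definition strict_chain n (p : 'I_n.+1 -> prime_idealr R) : Prop :=
  forall i j : 'I_n.+1, (i < j)%N ->
    {subset p i <= p j} /\ ~ {subset p j <= p i}.

Definition has_krull_dim (d : nat) : Prop :=
  (exists p : 'I_d.+1 -> prime_idealr R, strict_chain p) /\
  forall n (p : 'I_n.+1 -> prime_idealr R), strict_chain p -> (n <= d)%N.
End KrullDimension.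

Section VNumber.
Variables (K : fieldType) (n : nat).
Local Notation S := {mpoly K[n]}.
Variable I : idealr S.

(* p is the annihilator in S of an element of the S-module S/I, on which S acts
   through the projection. *)
Definition associated_prime (p : prime_idealr S) : Prop :=
  exists x : {ideal_quot I},
    forall a : S, (a \in p) = (\pi_{ideal_quot I} a * x == 0).

Definition colon (f : S) : {pred S} := [pred g : S | g * f \in I].

Definition v_degree (d : nat) : Prop :=
  (1 <= d)%N /\
  exists (f : S) (p : prime_idealr S),
    [/\ f \is d.-homog, associated_prime p & colon f =i p].

Definition is_v_number (d : nat) : Prop :=
  v_degree d /\ forall d', v_degree d' -> (d <= d')%N.
End VNumber.

Section EdgeIdeal.
Variables (K : fieldType) (n : nat) (e : rel 'I_n).
Local Notation S := {mpoly K[n]}.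

Definition in_edge_ideal (f : S) : bool :=
  `[< exists c : 'I_n -> 'I_n -> S,
        f = \sum_i \sum_(j | e i j) c i j * ('X_i * 'X_j) >].

Lemma edge_ideal_closed : idealr_closed in_edge_ideal.
Proof.
split => [||a f g].
- apply/asboolP; exists (fun _ _ => 0); apply/esym/big1 => i _.
  by apply: big1 => j _; rewrite mul0r.
- apply/negP => /asboolP [c /(congr1 (meval (fun=> 0)))].
  rewrite meval1 raddf_sum big1 => [|i _]; first by move/eqP; rewrite oner_eq0.
  rewrite raddf_sum big1 // => j _.
  by rewrite /= !mevalM mevalXU mul0r mulr0.
- move=> /asboolP [c ->] /asboolP [c' ->].
  apply/asboolP; exists (fun i j => a * c i j + c' i j).
  rewrite mulr_sumr -big_split; apply: eq_bigr => i _ /=.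
  rewrite mulr_sumr -big_split; apply: eq_bigr => j _ /=.
  by rewrite mulrDl -mulrA.
Qed.

HB.instance Definition _ :=
  isIdealr.Build S in_edge_ideal edge_ideal_closed.

Definition edge_ideal : idealr S := in_edge_ideal.
End EdgeIdeal.

Arguments edge_ideal K {n} e.

(* Main.v *)
(* Call a stable set A covering if its neighbourhood N(A) is a vertex
   cover. The v-number is the least size of a covering set: if A is covering,
   the colon ideal of the monomial with support A is the prime generated by the
   variables of N(A); conversely, if (I : f) is prime and m is a monomial of f
   outside I, the variables in (I : f) form a vertex cover contained in
   N(supp m), so supp m is covering, of size at most deg f.

   The dimension is the stability number. Variable primes give a chain of that
   length. For the upper bound, the variables outside the smallest prime of a
   chain form a stable set T. Elements x_i of p_(i+1) outside p_i admit no
   nontrivial polynomial relation over K, whereas more than |T| polynomials in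
   |T| variables always do, by counting monomials.

   Finally G is in W_2 iff all covering sets have maximum size. A covering set A
   and a vertex v outside N(A) and A cannot be separated by disjoint maximum
   stable sets; conversely, if two disjoint stable sets are enlarged as much as
   possible while remaining disjoint, both become covering sets. *)

Require Import Defs.
From HB Require Import structures.
From mathcomp Require Import all_boot all_order all_algebra.
From mathcomp Require Import boolp.
From mathcomp Require Import mpoly.

Set Implicit Arguments.
Unset Strict Implicit.
Unset Printing Implicit Defensive.

Import GRing.Theory.
Local Open Scope ring_scope.
Local Open Scope quotient_scope.

(** * Covering sets and the class W_2 *)

Section Graph.
Variables (V : finType) (e : rel V).
Hypothesis e_sym : ssrbool.symmetric e.
Hypothesis e_irr : irreflexive e.

Definition neighbours (A : {set V}) : {set V} :=
  [set j | [exists i in A, e i j]].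

Lemma neighboursP (A : {set V}) j :
  reflect (exists2 i, i \in A & e i j) (j \in neighbours A).
Proof. by rewrite inE; apply: (iffP exists_inP). Qed.

(* [~: neighbours A] is stable iff [neighbours A] is a vertex cover; this cover
   is then minimal, because each neighbour has a neighbour in [A]. *)
Definition cover_by_neighbours (A : {set V}) : Prop :=
  stable e A /\ stable e (~: neighbours A).

Lemma stable_disjoint_neighbours (A : {set V}) j :
  stable e A -> j \in A -> j \notin neighbours A.
Proof.
by move=> stA Aj; apply/neighboursP => -[i Ai]; apply/negP; exact: stA.
Qed.

Lemma stable_setU1 (A : {set V}) x :
  stable e A -> x \notin neighbours A -> stable e (x |: A).
Proof.
move=> stA nx; have nA y : y \in A -> ~~ e y x.
  by move=> Ay; apply: contra nx => eyx; apply/neighboursP; exists y.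
move=> i j /setU1P[->|Ai] /setU1P[->|Aj]; first by rewrite e_irr.
- by rewrite e_sym; exact: nA.
- exact: nA.
- exact: stA.
Qed.

Lemma exists_max_stable : exists A, max_stable e A.
Proof.
have st0 : `[< stable e set0 >] by apply/asboolP => i j; rewrite inE.
case: (@arg_maxnP _ set0 (fun A => `[< stable e A >]) (fun A => #|A|) st0).
move=> A /asboolP stA maxA.
by exists A; split=> // B stB; apply: maxA; apply/asboolP.
Qed.

(** A vertex outside the neighbourhood of [A] could be added to [A], so by maximality it already
    belongs to [A]. *)
Lemma max_stable_cover (A : {set V}) :
  max_stable e A -> cover_by_neighbours A.
Proof.
move=> [stA maxA]; split=> //.
suff subA x : x \notin neighbours A -> x \in A.
  by move=> i j; rewrite !in_setC => /subA Ai /subA Aj; exact: stA.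
move=> nx; case: (boolP (x \in A)) => // xA.
have := maxA _ (stable_setU1 stA nx).
by rewrite cardsU1 xA ltnn.
Qed.

(** Every stable set containing [A] lies in the stable set [~: neighbours A]. If the latter is [A],
    a maximum stable set containing [A] must be [A]. Otherwise such a set [A'], disjoint from a
    maximum stable set through some [v] of [~: neighbours A] outside [A], would equal
    [~: neighbours A] by cardinality and contain [v]. *)
Lemma W2_cover_max (A : {set V}) :
  W2 e -> cover_by_neighbours A -> max_stable e A.
Proof.
move=> [_ w2] [stA stC].
have sAC : A \subset ~: neighbours A.
  by apply/subsetP => x Ax; rewrite inE; exact: stable_disjoint_neighbours.
have in_C (A' : {set V}) : stable e A' -> A \subset A' ->
    A' \subset ~: neighbours A.
  move=> stA' /subsetP sA; apply/subsetP => x A'x; rewrite inE.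
  by apply/neighboursP => -[i /sA A'i]; apply/negP; exact: stA'.
have [sCA|/subsetPn[v Cv Av]] := boolP (~: neighbours A \subset A).
  have st0 : stable e set0 by move=> i j; rewrite inE.
  have d0 : [disjoint A & set0 : {set V}] by rewrite -setI_eq0 setI0.
  have [A' [_ [mA' _ _ sA _]]] := w2 A set0 stA st0 d0.
  have/eqP <- : A' == A.
    by rewrite eqEsubset sA (subset_trans (in_C _ mA'.1 sA)).
  by [].
have stv : stable e [set v] by move=> i j /set1P-> /set1P->; rewrite e_irr.
have dv : [disjoint A & [set v]] by rewrite disjoint_sym disjoints1.
have [A' [B' [mA' mB' dAB sA]]] := w2 A [set v] stA stv dv.
rewrite sub1set => B'v.
have /eqP A'C : A' == ~: neighbours A.
  by rewrite eqEcard in_C //=; [exact: mA'.2 | exact: mA'.1].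
by have := disjointFl dAB B'v; rewrite A'C Cv.
Qed.

(* The hypothesis on [x] says that no vertex outside [B] can be added to [A].
   So [~: neighbours A] is the union of [A] and of a part of [B] without
   neighbour in [A]. *)
Lemma maximal_pair_cover (A B : {set V}) :
    stable e A -> stable e B -> [disjoint A & B] ->
    (forall x, x \notin A :|: B -> x \in neighbours A) ->
  cover_by_neighbours A.
Proof.
move=> stA stB dAB maxA; split=> // i j; rewrite !in_setC => ni nj.
have nA x y : x \in A -> y \notin neighbours A -> ~~ e x y.
  by move=> Ax; apply: contra => exy; apply/neighboursP; exists x.
have inU x : x \notin neighbours A -> x \in A :|: B.
  by apply: contraR => /maxA.
case/setUP: (inU i ni) => [Ai|Bi]; first exact: nA.
case/setUP: (inU j nj) => [Aj|Bj]; first by rewrite e_sym; exact: nA.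
exact: stB.
Qed.

Lemma cover_max_W2 :
    (2 <= #|V|)%N -> (forall A, cover_by_neighbours A -> max_stable e A) ->
  W2 e.
Proof.
move=> V2 cov; split=> // A B stA stB dAB.
pose P (q : {set V} * {set V}) :=
  `[< [/\ stable e q.1, stable e q.2, [disjoint q.1 & q.2],
          A \subset q.1 & B \subset q.2] >].
have P0 : P (A, B) by apply/asboolP; split.
(* With the total size maximal, no vertex outside both sets can be added to either one. *)
case: (@arg_maxnP _ (A, B) P (fun q => #|q.1| + #|q.2|)%N P0).
move=> [A' B'] /asboolP /= [stA' stB' dAB' sA sB] maxAB.
exists A', B'; split=> //; apply: cov.
  apply: (@maximal_pair_cover _ B') => // x.
  rewrite in_setU negb_or => /andP[xA xB].
  apply: contraT => nx.
  have : P (x |: A', B').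
    apply/asboolP; split=> //=; first exact: stable_setU1.
      by rewrite -setI_eq0 setIUl setU_eq0 !setI_eq0 disjoints1 xB.
    exact: subset_trans (subsetUr _ _).
  by move/maxAB; rewrite /= cardsU1 xA addSn ltnn.
apply: (@maximal_pair_cover _ A') => //; first by rewrite disjoint_sym.
move=> x; rewrite in_setU negb_or => /andP[xB xA].
apply: contraT => nx.
have : P (A', x |: B').
  apply/asboolP; split=> //=; first exact: stable_setU1.
    by rewrite disjoint_sym -setI_eq0 setIUl setU_eq0 !setI_eq0 disjoints1 xA
      disjoint_sym.
  exact: subset_trans (subsetUr _ _).
by move/maxAB; rewrite /= cardsU1 xB addnS ltnn.
Qed.
End Graph.

(** * Prime ideals: quotients, chains and Krull dimension *)

Lemma prime_idealrX (R : comNzRingType) (p : prime_idealr R) x k :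
  x ^+ k \in p -> x \in p.
Proof.
elim: k => [|k IHk]; first by rewrite expr0 idealr1.
by rewrite exprS prime_idealrM => /orP[].
Qed.

Lemma exists_prime_idealr (R : comNzRingType) (P : {pred R}) :
  idealr_closed P -> prime_idealr_closed P -> exists p : prime_idealr R, p =i P.
Proof.
move=> idP prP.
pose p : prime_idealr R :=
  HB.pack (P : R -> bool) (isIdealr.Build R P idP)
    (isPrimeIdealrClosed.Build R P prP).
by exists p.
Qed.

Section PrimeIdeals.
Variable R : comNzRingType.

Lemma pi_eq0 (J : idealr R) a : (\pi_{ideal_quot J} a == 0) = (a \in J).
Proof.
by rewrite -[X in _ == X](rmorph0 \pi_{ideal_quot J}) -Quotient.idealrBE subr0.
Qed.

(** The image of [p] is tested on representatives; their choice does not matter because [p] contains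
    [J]. *)
Lemma prime_idealr_quot (J : idealr R) (p : prime_idealr R) :
    {subset J <= p} ->
  exists q : prime_idealr {ideal_quot J},
    forall a, (\pi_{ideal_quot J} a \in q) = (a \in p).
Proof.
move=> sJp.
have reprp a : (repr (\pi_{ideal_quot J} a) \in p) = (a \in p).
  have : a - repr (\pi_{ideal_quot J} a) \in p.
    by apply: sJp; rewrite Quotient.idealrBE reprK.
  by move=> h; rewrite -[in RHS](subrK (repr (\pi_{ideal_quot J} a)) a) rpredDl.
have [q qE] : exists q : prime_idealr {ideal_quot J},
    q =i [pred x | repr x \in p].
  apply: exists_prime_idealr => [|x y].
    split=> [||x y z]; rewrite ?inE.
    - by rewrite -(rmorph0 \pi_{ideal_quot J}) reprp rpred0.
    - by rewrite -(rmorph1 \pi_{ideal_quot J}) reprp idealr1.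
    - move=> yp zp; rewrite -[x]reprK -[y]reprK -[z]reprK.
      by rewrite -rmorphM -rmorphD reprp rpredD // idealMr.
  rewrite !inE -{1}[x]reprK -{1}[y]reprK -rmorphM reprp.
  by rewrite prime_idealrM.
by exists q => a; rewrite qE inE reprp.
Qed.

(* Coquand and Lombardi's argument: reading the exponents from the first one
   on, keep at step [k] the terms with the least exponent of [x k]; dividing by
   this power of [x k] is allowed since [x k] is not in [p k], and the terms
   that are left out lie in [p k.+1]. At the end one term remains. *)
Lemma strict_chain_indep n (p : 'I_n.+1 -> prime_idealr R) (x : 'I_n -> R)
    N (E : {set {ffun 'I_n -> 'I_N}}) (c : {ffun 'I_n -> 'I_N} -> R) :
    strict_chain p ->
    (forall i : 'I_n, x i \in p (lift ord0 i)) ->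
    (forall i : 'I_n, x i \notin p (widen_ord (leqnSn n) i)) ->
    E != set0 -> (forall a, a \in E -> c a \notin p ord_max) ->
  \sum_(a in E) c a * \prod_i x i ^+ a i \notin p ord0.
Proof.
move=> chp xS xn E0 cE; apply/negP => sum0.
(* The powers of index below [k] have been divided out; at [k = n] only the coefficient [c a] is
   left. *)
pose term (k : nat) (a : {ffun 'I_n -> 'I_N}) :=
  c a * \prod_(i < n | (k <= i)%N) x i ^+ a i.
have step k : (k <= n)%N -> exists E' : {set {ffun 'I_n -> 'I_N}},
    [/\ E' != set0, E' \subset E,
      forall a b (i : 'I_n), a \in E' -> b \in E' -> (i < k)%N -> a i = b i &
      \sum_(a in E') term k a \in p (inord k)].
  elim: k => [_|k IHk kn].
    exists E; split=> //.
    suff -> : inord 0 = ord0 :> 'I_n.+1 by [].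
    by apply: val_inj; rewrite /= inordK.
  have [E' [/set0Pn[a0 E'a0] sE' eqE' sumE']] := IHk (ltnW kn).
  pose j := Ordinal kn.
  have [a1 E'a1 min1] : exists2 a1, a1 \in E' &
      forall a, a \in E' -> (a1 j <= a j)%N.
    case: (@arg_minnP _ a0 (mem E') (fun a => a j : nat) E'a0) => a1.
    by exists a1.
  have pk : inord k = widen_ord (leqnSn n) j.
    by apply: val_inj; rewrite /= inordK // ltnW.
  have pk1 : inord k.+1 = lift ord0 j.
    by apply: val_inj; rewrite /= inordK.
  pose rest (a : {ffun 'I_n -> 'I_N}) := x j ^+ (a j - a1 j) * term k.+1 a.
  have termE a : a \in E' -> term k a = x j ^+ a1 j * rest a.
    move=> E'a; rewrite /rest mulrA -exprD subnKC ?min1 // /term (bigD1 j) //=.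
    rewrite mulrCA; congr (_ * (_ * _)); apply: eq_bigl => i.
    by rewrite ltn_neqAle eq_sym andbC.
  have rest_in : \sum_(a in E') rest a \in p (inord k.+1).
    apply: (chp (inord k) _ _).1; first by rewrite !inordK // ltnW.
    move: sumE'; rewrite (eq_bigr _ termE) -mulr_sumr prime_idealrM.
    by case/orP=> // /prime_idealrX; rewrite pk (negbTE (xn j)).
  exists [set a in E' | a j == a1 j]; split.
  - by apply/set0Pn; exists a1; rewrite inE E'a1 /=.
  - by apply: subset_trans sE'; apply/subsetP => a; rewrite inE => /andP[].
  - move=> a b i; rewrite !inE => /andP[E'a /eqP aj] /andP[E'b /eqP bj].
    rewrite ltnS leq_eqVlt => /orP[/eqP ik|]; last exact: eqE'.
    by have -> : i = j by [apply: val_inj]; rewrite aj bj.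
  - move: rest_in.
    rewrite (bigID (fun a : {ffun 'I_n -> 'I_N} => a j == a1 j)) /=.
    rewrite rpredDr; last first.
      apply: rpred_sum => a /andP[E'a ne]; rewrite /rest mulrC idealMr //.
      have : (0 < a j - a1 j)%N.
        by rewrite subn_gt0 ltn_neqAle min1 // eq_sym val_eqE ne.
      by case: (_ - _)%N => // d _; rewrite exprSr idealMr // pk1.
    rewrite [in X in _ -> X]
      (eq_big (fun a => (a \in E') && (a j == a1 j)) rest) //.
      by move=> a; rewrite inE.
    by move=> a; rewrite inE => /andP[_ /eqP aj]; rewrite /rest aj subnn mul1r.
have [E' [/set0Pn[a E'a] /subsetP sE' eqE' sumE']] := step n (leqnn n).
have := cE a (sE' a E'a); move: sumE'; rewrite (big_pred1 a) => [|b].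
  rewrite /term big_pred0 ?mulr1 => [|i]; last by rewrite leqNgt ltn_ord.
  suff -> : inord n = ord_max :> 'I_n.+1 by move->.
  by apply: val_inj; rewrite /= inordK.
apply/idP/eqP => [E'b|-> //]; apply/ffunP => i.
exact: eqE'.
Qed.

Lemma krull_dim_unique d d' :
  has_krull_dim R d -> has_krull_dim R d' -> d = d'.
Proof.
move=> [[p chp] max] [[p' chp'] max'].
by apply/eqP; rewrite eqn_leq (max' _ _ chp) (max _ _ chp').
Qed.
End PrimeIdeals.

(** * Supports of monomials, variable primes and algebraic dependence *)

Section Monomials.
Variables (K : fieldType) (s : nat).
Local Notation S := {mpoly K[s]}.

Definition mnm_supp (m : 'X_{1..s}) : {set 'I_s} := [set i | m i != 0%N].

Lemma mnm_suppD m1 m2 : mnm_supp (m1 + m2) = mnm_supp m1 :|: mnm_supp m2.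
Proof. by apply/setP => i; rewrite !inE mnmDE addn_eq0 negb_and. Qed.

Lemma mnm_supp0 : mnm_supp 0 = set0.
Proof. by apply/setP => i; rewrite !inE mnm0E. Qed.

Lemma mnm_suppU i : mnm_supp U_(i) = [set i].
Proof. by apply/setP => j; rewrite !inE mnm1E eqb0 negbK eq_sym. Qed.

Lemma card_mnm_supp m : (#|mnm_supp m| <= mdeg m)%N.
Proof.
rewrite mdegE -sum1_card big_mkcond; apply: leq_sum => i _.
by rewrite inE; case: eqP => // /eqP; rewrite lt0n.
Qed.

Definition zero_out (C : {set 'I_s}) : S -> S :=
  mmap (@mpolyC s K) (fun i => if i \in C then 0 else 'X_i).

HB.instance Definition _ C := GRing.RMorphism.copy (zero_out C)
  (mmap (@mpolyC s K) (fun i => if i \in C then 0 else 'X_i)).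

Lemma mcoeff_zero_out C f m :
  (zero_out C f)@_m = if [disjoint mnm_supp m & C] then f@_m else 0.
Proof.
have mono m' : mmap1 (fun i => if i \in C then 0 else 'X_i : S) m' =
    if [disjoint mnm_supp m' & C] then 'X_[m'] else 0.
  case: ifPn => [dis|/pred0Pn[i /= /andP[mi Ci]]].
    rewrite mpolyXE_id; apply: eq_bigr => i _.
    case: ifP => // Ci; have := disjointFl dis Ci.
    by rewrite inE => /negbFE/eqP->; rewrite !expr0.
  rewrite inE in mi; rewrite /mmap1 (bigD1 i) //= Ci expr0n.
  by rewrite (negbTE mi) mul0r.
rewrite [f in RHS]mpolyE raddf_sum /= /zero_out /mmap raddf_sum /=.
case: ifPn => dm; last first.
  apply: big1 => m' _; rewrite mono mul_mpolyC mcoeffZ.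
  case: ifPn => dm'; last by rewrite mcoeff0 mulr0.
  rewrite mcoeffX; case: eqP => [mm'|]; last by rewrite mulr0.
  by rewrite -mm' dm' in dm.
apply: eq_bigr => m' _; rewrite mono mul_mpolyC !mcoeffZ.
case: ifPn => // dm'; rewrite mcoeffX mcoeff0.
by case: eqP => // mm'; rewrite mm' dm in dm'.
Qed.

Lemma zero_out_eq0 C f :
  (zero_out C f == 0) = all (fun m => ~~ [disjoint mnm_supp m & C]) (msupp f).
Proof.
apply/eqP/allP => [f0 m|meet].
  rewrite mcoeff_msupp; apply: contraNN => dm.
  by have := mcoeff_zero_out C f m; rewrite f0 dm mcoeff0 => <-.
apply/mpolyP => m; rewrite mcoeff_zero_out mcoeff0.
case: ifPn => // dm; apply: memN_msupp_eq0.
by apply/negP => /meet; rewrite dm.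
Qed.

(** The ideal generated by the variables of [C] is the kernel of [zero_out C], a morphism into a
    domain. *)
Lemma exists_variable_prime (C : {set 'I_s}) : exists p : prime_idealr S,
  forall f, (f \in p) = all (fun m => ~~ [disjoint mnm_supp m & C]) (msupp f).
Proof.
have [p pE] : exists p : prime_idealr S, p =i [pred f | zero_out C f == 0].
  apply: exists_prime_idealr => [|f g]; last first.
    by rewrite !inE rmorphM mulf_eq0.
  split=> [||a f g]; rewrite !inE; first by rewrite rmorph0.
    by rewrite rmorph1 oner_eq0.
  by move=> /eqP f0 /eqP g0; rewrite rmorphD rmorphM /= f0 g0 mulr0 addr0.
by exists p => f; rewrite pE inE zero_out_eq0.
Qed.

(* With exponents below [N], the [N ^ n] products of powers of the [x i] lie in
   the span of the monomials in the variables of [T] with exponents [O(N)], of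
   which there are [O(N ^ #|T|)]. *)
Lemma mpoly_dependent (T : {set 'I_s}) n (x : 'I_n -> S) :
    (forall i m, m \in msupp (x i) -> mnm_supp m \subset T) ->
    (#|T| < n)%N ->
  exists N (c : {ffun 'I_n -> 'I_N} -> K),
    (exists a, c a != 0) /\ \sum_a c a *: \prod_i x i ^+ a i = 0.
Proof.
move=> xT Tn.
pose D := (\max_i msize (x i))%N.
pose bounded d (f : S) :=
  forall m, m \in msupp f -> mnm_supp m \subset T /\ (mdeg m <= d)%N.
have bounded1 : bounded 0%N 1.
  by move=> m; rewrite msupp1 inE => /eqP->; rewrite mnm_supp0 sub0set mdeg0.
have boundedM d1 d2 f g :
    bounded d1 f -> bounded d2 g -> bounded (d1 + d2)%N (f * g).
  move=> bf bg m /msuppM_le /allpairsP[[m1 m2] /= [/bf[s1 l1] /bg[s2 l2] ->]].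
  by rewrite mnm_suppD subUset s1 s2 mdegD leq_add.
have boundedX k f : bounded D f -> bounded (k * D)%N (f ^+ k).
  move=> bf; elim: k => [|k IHk]; first by rewrite expr0.
  by rewrite exprS mulSn; apply: boundedM.
have bx i : bounded D (x i).
  move=> m mx; split; first exact: xT mx.
  by apply: leq_trans (ltnW (msize_mdeg_lt mx)) _; apply: (leq_bigmax i).
(* This choice gives [(N * (n * D).+1) ^ #|T| < N ^ #|T|.+1 <= N ^ n], while
   [b.+1 <= N * (n * D).+1] for the degree bound [b]. *)
pose N := ((n * D).+1 ^ #|T|).+1.
pose b := (n * (N * D))%N.
pose P (a : {ffun 'I_n -> 'I_N}) := \prod_i x i ^+ a i.
have bP a : bounded b (P a).
  have : bounded (\sum_i a i * D)%N (P a).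
    by apply: (big_ind2 bounded) => // *; [exact: boundedM | exact: boundedX].
  move=> h m /h[-> le_m]; split=> //; apply: leq_trans le_m _.
  apply: (@leq_trans (\sum_(i < n) N * D)%N).
    by apply: leq_sum => i _; rewrite leq_mul2r ltnW ?orbT.
  by rewrite sum_nat_const card_ord.
pose G := pffun_on (ord0 : 'I_b.+1) (mem T) predT.
pose mon (g : {ffun 'I_s -> 'I_b.+1}) := [multinom (g i : nat) | i < s].
(* Row [r] lists the coefficients of one product of powers. There are more rows than columns, so a
   nonzero vector of the left kernel gives the relation. *)
pose M := \matrix_(r < #|{: {ffun 'I_n -> 'I_N}}|, k < #|G|)
   (P (enum_val r))@_(mon (enum_val k)).
have ltGF : (#|G| < #|{: {ffun 'I_n -> 'I_N}}|)%N.
  rewrite card_pffun_on card_ffun !card_ord.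
  apply: (@leq_ltn_trans ((N * (n * D).+1) ^ #|T|)).
    have [->|T0] := posnP #|T|; first by rewrite !expn0.
    by rewrite leq_exp2r // mulnS mulnCA -addn1 addnC leq_add2r.
  rewrite expnMn; apply: (@leq_trans (N ^ #|T|.+1)); last by rewrite leq_pexp2l.
  by rewrite expnSr ltn_pmul2l ?expn_gt0.
have : kermx M != 0.
  rewrite kermx_eq0 /row_free; apply: contraTN ltGF => /eqP <-.
  by rewrite -leqNgt rank_leq_col.
case/rowV0Pn => u /sub_kermxP uM u0.
exists N, (fun a => u 0 (enum_rank a)); split.
  have [r ur] : exists r, u 0 r != 0.
    by case/rV0Pn: u0 => r; exists r.
  by exists (enum_val r); rewrite enum_valK.
apply/mpolyP => m; rewrite raddf_sum mcoeff0 /=.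
have [/andP[mT mb]|nm] :=
  boolP ((mnm_supp m \subset T) && (mdeg m <= b)%N); last first.
  apply: big1 => a _; rewrite mcoeffZ memN_msupp_eq0 ?mulr0 //.
  by apply: contraNN nm => /bP[-> ->].
pose g : {ffun 'I_s -> 'I_b.+1} := [ffun i => inord (m i)].
have mi i : (m i < b.+1)%N.
  by rewrite ltnS; apply: leq_trans mb; rewrite mdegE (bigD1 i) //= leq_addr.
have gG : g \in G.
  apply/pffun_onP; split=> //; apply/subsetP => i.
  rewrite inE ffunE; apply: contraR => Ti.
  apply/eqP/val_inj; rewrite /= inordK //; apply/eqP; apply: contraNT Ti => m0.
  by apply: (subsetP mT); rewrite inE.
have mE : mon g = m by apply/mnmP => i; rewrite mnmE ffunE inordK.
have /matrixP/(_ 0 (enum_rank_in gG g)) := uM; rewrite !mxE => uM0.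
rewrite -[RHS]uM0.
rewrite (reindex (@enum_val _ predT)) /=; last exact: onW_bij (enum_val_bij _).
apply: eq_bigr => r _; rewrite mcoeffZ enum_valK mxE enum_rankK_in // mE.
by [].
Qed.
End Monomials.

(** * The edge ideal: membership, v-number and dimension *)

Section EdgeIdealTheory.
Variables (K : fieldType) (s : nat) (e : rel 'I_s).
Hypothesis e_sym : ssrbool.symmetric e.
Hypothesis e_irr : irreflexive e.
Local Notation S := {mpoly K[s]}.
Local Notation I := (edge_ideal K e).

Lemma mpolyX_dvd i (m : 'X_{1..s}) :
  m i != 0%N -> 'X_[m] = 'X_[m - U_(i)] * 'X_i :> S.
Proof. by rewrite -lep1mP => im; rewrite -mpolyXD submK. Qed.

Lemma edge_ideal_edge i j : e i j -> 'X_i * 'X_j \in I.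
Proof.
move=> eij; apply/asboolP; exists (fun k l => ((k == i) && (l == j))%:R).
rewrite (bigD1 i) //= (bigD1 j) //= !eqxx mul1r.
rewrite big1 ?addr0 => [|l /andP[_ /negbTE->]].
  rewrite big1 ?addr0 // => k /negbTE ki.
  by apply: big1 => l _; rewrite ki mul0r.
by rewrite mul0r.
Qed.

Lemma edge_idealP f :
  reflect (forall m, m \in msupp f -> ~ stable e (mnm_supp m)) (f \in I).
Proof.
apply: (iffP idP) => [/asboolP[c ->] m|nst].
  rewrite mcoeff_msupp => /negP + stm; apply.
  rewrite raddf_sum big1 // => i _; rewrite raddf_sum big1 // => j eij.
  apply: memN_msupp_eq0; rewrite -mpolyXD (perm_mem (msuppMX _ _)).
  apply/mapP => -[m' _ mE]; have := stm i j.
  by rewrite mE !mnm_suppD !mnm_suppU !inE !eqxx !orbT eij => /(_ isT isT).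
rewrite [f]mpolyE big_seq; apply: rpred_sum => m /nst nstm.
rewrite -mul_mpolyC idealMr //.
have [i [j [mi mj eij]]] : exists i j, [/\ m i != 0%N, m j != 0%N & e i j].
  apply: contrapT => no; apply: nstm => i j; rewrite !inE => mi mj.
  by apply/negP => eij; apply: no; exists i, j.
(* As [e] is irreflexive, [i] and [j] differ, so ['X_j] still divides the monomial after one factor
   ['X_i] is removed. *)
rewrite (mpolyX_dvd mi) (@mpolyX_dvd j) -?mulrA; last first.
  rewrite mnmBE mnm1E; case: (i =P j) => [ij|_]; last by rewrite subn0.
  by rewrite ij e_irr in eij.
by rewrite idealMr // mulrC edge_ideal_edge.
Qed.

Lemma v_degree_cover d :
  v_degree I d -> exists2 A, cover_by_neighbours e A & (#|A| <= d)%N.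
Proof.
move=> [_ [f [p [homf _ colE]]]].
(* Otherwise [f] would lie in [I], and [1] in the prime [p]. *)
have [m mf stm] : exists2 m, m \in msupp f & stable e (mnm_supp m).
  apply: contrapT => no; have := colE 1.
  rewrite inE mul1r idealr1 => /negP; apply.
  by apply/edge_idealP => m mf stm; apply: no; exists m.
exists (mnm_supp m); last first.
  apply: leq_trans (card_mnm_supp m) _.
  by have /dhomogP/(_ m mf) -> := homf.
(* Multiplication by ['X_k] cancels no monomial, so adding [k] to the stable support of [m] must
   create an edge. *)
have pN k : 'X_k \in p -> k \in neighbours e (mnm_supp m).
  rewrite -colE inE mulrC => /edge_idealP/(_ (U_(k) + m)%MM).
  rewrite mcoeff_msupp mcoeffMX -mcoeff_msupp => /(_ mf) nst.
  apply: contraT => nk; case: nst; rewrite mnm_suppD mnm_suppU.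
  exact: stable_setU1.
split=> // i j; rewrite !in_setC => ni nj; apply/negP => eij.
have : 'X_i * 'X_j \in p.
  by rewrite -colE inE mulrC idealMr // edge_ideal_edge.
by rewrite prime_idealrM => /orP[] /pN; apply/negP.
Qed.

Lemma cover_v_degree (A : {set 'I_s}) :
  cover_by_neighbours e A -> (0 < #|A|)%N -> v_degree I #|A|.
Proof.
move=> [stA stC] A0; split=> //.
pose mA : 'X_{1..s} := [multinom (i \in A : nat) | i < s].
have suppA : mnm_supp mA = A.
  by apply/setP => i; rewrite inE mnmE eqb0 negbK.
have [p pE] := exists_variable_prime K (neighbours e A).
(* A monomial that avoids [neighbours e A] has, together with [A], its support in the stable set
   [~: neighbours e A]; a variable of [neighbours e A] completes an edge with a vertex of [A]. *)
have colE g : (g * 'X_[mA] \in I) = (g \in p).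
  rewrite pE; apply/edge_idealP/allP => [nst m mg|meet m].
    apply/negP => dis; apply: (nst (mA + m)%MM).
      by rewrite (perm_mem (msuppMX _ _)) map_f.
    rewrite mnm_suppD suppA => i j iU jU; apply: stC; rewrite in_setC.
      case/setUP: iU => [|im]; first exact: stable_disjoint_neighbours.
      by rewrite (disjointFr dis im).
    case/setUP: jU => [|jm]; first exact: stable_disjoint_neighbours.
    by rewrite (disjointFr dis jm).
  rewrite (perm_mem (msuppMX _ _)) => /mapP[m' /meet /pred0Pn[j /= /andP[]]].
  move=> jm jN ->.
  rewrite mnm_suppD suppA => st.
  have [i iA eij] := neighboursP _ _ _ jN.
  by have := st i j; rewrite !in_setU iA jm orbT eij => /(_ isT isT).
exists 'X_[mA], p; split=> [||g]; last by rewrite inE colE.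
  rewrite dhomogX /= mdegE -sum1_card [X in _ == X]big_mkcond; apply/eqP.
  by apply: eq_bigr => i _; rewrite mnmE; case: (i \in A).
by exists (\pi_{ideal_quot I} 'X_[mA]) => a; rewrite -rmorphM pi_eq0 colE.
Qed.

(** Every edge has an end in the vertex cover [C]. *)
Lemma edge_ideal_sub_variable_prime (C : {set 'I_s}) (f : S) :
    stable e (~: C) -> f \in I ->
  all (fun m => ~~ [disjoint mnm_supp m & C]) (msupp f).
Proof.
move=> stC /edge_idealP nst; apply/allP => m /nst nstm.
apply/negP => dis; apply: nstm => i j im jm; apply: stC; rewrite in_setC.
  by rewrite (disjointFr dis im).
by rewrite (disjointFr dis jm).
Qed.

Lemma variable_prime_chain (A : {set 'I_s}) :
    stable e A ->
  exists p : 'I_#|A|.+1 -> prime_idealr {ideal_quot I}, strict_chain p.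
Proof.
move=> stA.
(* The vertices outside [A] and the first [j] vertices of [A]: a vertex cover that gains one vertex
   at each step. *)
pose C (j : nat) := [set x | (x \in A) ==> (index x (enum A) < j)%N].
have ex_p (j : 'I_#|A|.+1) : exists q : prime_idealr {ideal_quot I},
    forall f, (\pi_{ideal_quot I} f \in q) =
      all (fun m => ~~ [disjoint mnm_supp m & C j]) (msupp f).
  have [P PE] := exists_variable_prime K (C j).
  have [|q qE] := @prime_idealr_quot _ I P.
    move=> f fI; rewrite PE; apply: edge_ideal_sub_variable_prime fI => x y.
    by rewrite !inE !negb_imply => /andP[xA _] /andP[yA _]; apply: stA.
  by exists q => f; rewrite qE PE.
have [p pE] := fin_all_exists ex_p.
exists p => i j ij; split=> [x|].
  rewrite -[x]reprK !pE; apply: sub_all => m; apply: contraNN.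
  apply: disjointWr; apply/subsetP => y; rewrite !inE.
  by move=> /implyP h; apply/implyP => /h /ltn_trans; apply.
have iA : (i < #|A|)%N by apply: leq_trans ij _; rewrite -ltnS.
pose v := enum_val (Ordinal iA).
have idx : index v (enum A) = i.
  by rewrite /v /enum_val index_uniq ?enum_uniq -?cardE.
move=> /(_ (\pi_{ideal_quot I} 'X_v)).
rewrite !pE msuppX !all_seq1 mnm_suppU !disjoints1 !negbK !inE idx.
by rewrite enum_valP /= ij ltnn => /(_ isT).
Qed.

Lemma edge_ideal_krull_dim (A : {set 'I_s}) :
  max_stable e A -> has_krull_dim {ideal_quot I} #|A|.
Proof.
move=> [stA maxA]; split=> [|n p chp]; first exact: variable_prime_chain.
pose pi := \pi_{ideal_quot I}.
have p0 (j : 'I_n.+1) : {subset p ord0 <= p j}.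
  have [->|j0] := eqVneq j ord0; first by [].
  by apply: (chp ord0 j _).1; rewrite lt0n.
pose C := [set i | pi 'X_i \in p ord0].
have stC : stable e (~: C).
  move=> i j; rewrite !inE => ni nj; apply/negP => /edge_ideal_edge.
  rewrite -pi_eq0 rmorphM => /eqP ij0.
  have : pi 'X_i * pi 'X_j \in p ord0 by rewrite /pi ij0 rpred0.
  by rewrite prime_idealrM (negbTE ni) (negbTE nj).
rewrite leqNgt; apply/negP => An.
have Cn : (#|~: C| < n)%N by apply: leq_ltn_trans An; exact: maxA.
have C0 f :
    all (fun m => ~~ [disjoint mnm_supp m & C]) (msupp f) -> pi f \in p ord0.
  move=> /allP meet; rewrite [f]mpolyE /pi rmorph_sum big_seq.
  apply: rpred_sum => m /meet /pred0Pn[i /= /andP[]]; rewrite !inE => mi Ci.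
  by rewrite -mul_mpolyC (mpolyX_dvd mi) mulrA rmorphM idealMr.
have ex_y (i : 'I_n) : exists2 z : {ideal_quot I},
    z \in p (lift ord0 i) & z \notin p (widen_ord (leqnSn n) i).
  apply: contrapT => no.
  apply: (chp (widen_ord (leqnSn n) i) (lift ord0 i) _).2 => // z zS.
  by apply: contraT => zn; case: no; exists z.
have [y yS yn] := fin_all_exists2 ex_y.
(* Setting the variables of [C] to zero changes a representative by an element of the smallest
   prime, so its place in the chain is kept and only the variables of [~: C] remain. *)
pose x i := zero_out C (repr (y i)).
have xE i (j : 'I_n.+1) : (pi (x i) \in p j) = (y i \in p j).
  have d0 : pi (repr (y i) - x i) \in p j.
    apply: p0; apply: C0; rewrite -zero_out_eq0 rmorphB /=.
    apply/eqP/mpolyP => m; rewrite mcoeffB !mcoeff_zero_out mcoeff0.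
    by case: ifP => _; rewrite subrr.
  move: d0; rewrite /pi rmorphB /= reprK => d0.
  by rewrite -[in RHS](subrK (pi (x i)) (y i)) rpredDl.
have xT i m : m \in msupp (x i) -> mnm_supp m \subset ~: C.
  rewrite mcoeff_msupp mcoeff_zero_out -disjoints_subset.
  by case: ifP => //; rewrite eqxx.
have [N [c [[a0 ca0] sumc]]] := mpoly_dependent xT Cn.
(* The nonzero coefficients are units, hence outside [p ord_max]. *)
pose E := [set a | c a != 0].
have /negP[] :
    \sum_(a in E) pi (c a)%:MP * \prod_i pi (x i) ^+ a i \notin p ord0.
  apply: strict_chain_indep chp _ _ _ _ => [i|i||a].
  - by rewrite xE.
  - by rewrite xE.
  - by apply/set0Pn; exists a0; rewrite inE.
  - rewrite inE => ca; apply: contraT => /negPn cp.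
    have : pi (c a)^-1%:MP * pi (c a)%:MP \in p ord_max by rewrite idealMr.
    by rewrite -rmorphM -mpolyCM mulVf // rmorph1 idealr1.
suff -> : \sum_(a in E) pi (c a)%:MP * \prod_i pi (x i) ^+ a i = 0.
  exact: rpred0.
transitivity (pi (\sum_a c a *: \prod_i x i ^+ a i)); last first.
  by rewrite sumc /pi rmorph0.
rewrite /pi rmorph_sum big_mkcond /=.
apply: eq_bigr => a _; rewrite -mul_mpolyC rmorphM rmorph_prod inE.
case: ifPn => [_|/negPn/eqP->]; last by rewrite mpolyC0 rmorph0 mul0r.
by congr (_ * _); apply: eq_bigr => i _; rewrite rmorphXn.
Qed.
End EdgeIdealTheory.

(** * The v-number compared with the dimension *)

Theorem theorem4p5 (K : fieldType) (s : nat) (e : rel 'I_s) :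
  (1 <= s)%N -> ssrbool.symmetric e -> irreflexive e ->
  (forall i : 'I_s, exists j : 'I_s, e i j) ->
  W2 e <->
  exists d : nat,
    is_v_number (edge_ideal K e) d /\
    has_krull_dim {ideal_quot (edge_ideal K e)} d.
Proof.
move=> s0 e_sym e_irr iso.
(* The empty set has no neighbours, so it is covering only if there are no edges; sizes of covering
   sets thus meet the bound [1 <= d] on v-degrees. *)
have cover_gt0 A : cover_by_neighbours e A -> (0 < #|A|)%N.
  move=> [_ stC]; rewrite card_gt0; apply/negP => /eqP A0.
  have nN k : k \in ~: neighbours e A.
    by rewrite in_setC; apply/neighboursP => -[i]; rewrite A0 inE.
  have [j eij] := iso (Ordinal s0).
  by have := stC _ _ (nN (Ordinal s0)) (nN j); rewrite eij.
have [A0 mA0] := exists_max_stable e.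
have dimE := edge_ideal_krull_dim K e_irr mA0.
split=> [w2|[d [[_ vmin] dimd]]].
  exists #|A0|; split=> //; split.
    have covA0 := max_stable_cover e_sym e_irr mA0.
    exact: cover_v_degree (cover_gt0 _ covA0).
  move=> d' /(v_degree_cover e_sym e_irr)[A covA le_d'].
  apply: leq_trans le_d'.
  by apply: (W2_cover_max e_irr w2 covA).2; exact: mA0.1.
apply: cover_max_W2 => // [|A covA].
  have [j eij] := iso (Ordinal s0).
  apply/card_gt1P; exists (Ordinal s0), j; split=> //.
  by apply: contraTneq eij => <-; rewrite e_irr.
split=> [|B stB]; first exact: covA.1.
(* The stability number [#|A0|] is the dimension [d], hence the v-number, which bounds the size of
   the covering set [A] from below. *)
apply: leq_trans (mA0.2 _ stB) _.
rewrite (krull_dim_unique dimE dimd).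
exact: vmin (cover_v_degree K e_irr covA (cover_gt0 _ covA)).
Qed.
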